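(* Let $X$ be an approximately ultrahomogeneous (AUH) Banach space and let $Y$ be a subspace of $X$. Then: (1) Any surjective linear isometry $t$ on $Y$ extends uniquely to a surjective linear isometry $\tilde t$ on $\mathrm{Env}(Y)$. (2) The map $t\mapsto\tilde t$ defines a topological group embedding of $\mathrm{Isom}(Y)$ into $\mathrm{Isom}(\mathrm{Env}(Y))$. (3) This is the unique such map for which $\tilde t$ is an extension of $t$ for each $t\in\mathrm{Isom}(Y)$. Consequently the inclusion $Y\subseteq\mathrm{Env}(Y)$ is a linear $g$-embedding.
   Context: $\mathrm{Isom}(Z)$ is the group of surjective linear isometries of a Banach space $Z$, equipped with the strong operator topology (SOT, pointwise norm convergence). $X$ is approximately ultrahomogeneous (AUH) if for every finite-dimensional subspace $F$ of $X$, every linear isometric embedding $t:F\to X$ and every $\varepsilon>0$ there is $T\in\mathrm{Isom}(X)$ with $\|T|_F-t\|\le\varepsilon$. The isometric envelope $\mathrm{Env}(Y)$ is the set of $x\in X$ such that whenever a net $(T_i)_{i}$ in $\mathrm{Isom}(X)$ satisfies $T_i y\to y$ for every $y\in Y$, then $T_i x\to x$. A subspace $Y$ of a Banach space $Z$ is a linear $g$-embedding if there is an embedding of topological groups $e:\mathrm{Isom}(Y)\to\mathrm{Isom}(Z)$ such that $e(h)|_Y=h$ for every $h\in\mathrm{Isom}(Y)$. *)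

(* Defs.v *)
From HB Require Import structures.
From mathcomp Require Import all_boot all_order all_algebra.
From mathcomp Require Import all_classical all_reals all_analysis.

Set Implicit Arguments.
Unset Strict Implicit.
Unset Printing Implicit Defensive.

Import Order.TTheory GRing.Theory Num.Theory.
Import numFieldNormedType.Exports.

Local Open Scope classical_set_scope.
Local Open Scope ring_scope.

(* [monoid.v] provides possibly infinite groups, but the library has no
   multiplicative topological groups. *)
HB.mixin Record isTopologicalGroup G & Group G & Topological G := {
  mulg_continuous : continuous (fun p : G * G => (p.1 * p.2)%g);
  invg_continuous : continuous (fun g : G => g^-1%g)
}.

#[short(type="topologicalGroupType")]
HB.structure Definition TopologicalGroup :=
  {G of Group G & Topological G & isTopologicalGroup G}.

(* An injective homomorphism that is a homeomorphism onto its image, the image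
   carrying the relative topology. *)
Definition topological_group_embedding (G H : topologicalGroupType)
    (e : G -> H) : Prop :=
  [/\ {morph e : g h / (g * h)%g},
      injective e,
      continuous e
    & forall U : set G, open U ->
        exists2 V : set H, open V & e @` U = range e `&` V].

Section Isom.
Context {K : numFieldType}.
Implicit Type Z : normedModType K.

Record isom Z := Isom {
  isom_linear :> {linear Z -> Z};
  isom_norm : forall z, `|isom_linear z| = `|z|;
  isom_surj : forall w, exists z, isom_linear z = w
}.

Lemma isom_ext Z (f g : isom Z) : f =1 g -> f = g.
Proof.
case: f g => [f fN fS] [g gN gS] /= fg.
have {}fg : f = g.
  case: f g {fN fS gN gS} fg => [f fP] [g gP] /= /funext fg.
  subst g; congr GRing.Linear.Pack.
  case: fP gP => [[fD] [fZ]] [[gD] [gZ]]; congr GRing.Linear.Class.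
    by congr GRing.isNmodMorphism.Axioms_; exact: Prop_irrelevance.
  by congr GRing.isScalable.Axioms_; exact: Prop_irrelevance.
by subst g; congr Isom; exact: Prop_irrelevance.
Qed.

HB.instance Definition _ Z := gen_eqMixin (isom Z).
HB.instance Definition _ Z := gen_choiceMixin (isom Z).

Lemma isom_inj Z (f : isom Z) : injective f.
Proof.
move=> x y fxy; apply/eqP; rewrite -subr_eq0 -normr_eq0 -(isom_norm f).
by rewrite linearB fxy subrr normr0.
Qed.

Definition isom_id Z : isom Z.
Proof.
apply: (@Isom Z idfun) => // w; by exists w.
Defined.

Definition isom_comp Z (f g : isom Z) : isom Z.
Proof.
apply: (@Isom Z (f \o g)) => [z|w] /=; first by rewrite !isom_norm.
by have [y <-] := isom_surj f w; have [x <-] := isom_surj g y; exists x.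
Defined.

Definition isom_inv_fun Z (f : isom Z) (w : Z) : Z := projT1 (cid (isom_surj f w)).

Lemma isom_inv_funK Z (f : isom Z) : cancel (isom_inv_fun f) f.
Proof. by move=> w; rewrite /isom_inv_fun; case: cid. Qed.

Lemma isom_inv_linear Z (f : isom Z) : linear (isom_inv_fun f).
Proof.
by move=> a x y; apply: (@isom_inj _ f); rewrite linearP !isom_inv_funK.
Qed.

HB.instance Definition _ Z (f : isom Z) :=
  GRing.isLinear.Build K Z Z *:%R (isom_inv_fun f) (isom_inv_linear f).

Definition isom_inv Z (f : isom Z) : isom Z.
Proof.
apply: (@Isom Z (isom_inv_fun f)) => [z|w].
  by rewrite /= -{2}(isom_inv_funK f z) isom_norm.
by exists (f w); apply: (@isom_inj _ f); rewrite isom_inv_funK.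
Defined.

Fact isom_compA Z : associative (@isom_comp Z).
Proof. by move=> f g h; exact: isom_ext. Qed.
Fact isom_comp1f Z : left_id (isom_id Z) (@isom_comp Z).
Proof. by move=> f; exact: isom_ext. Qed.
Fact isom_compf1 Z : right_id (isom_id Z) (@isom_comp Z).
Proof. by move=> f; exact: isom_ext. Qed.
Fact isom_compfV Z : right_inverse (isom_id Z) (@isom_inv Z) (@isom_comp Z).
Proof. by move=> f; apply: isom_ext => z /=; rewrite isom_inv_funK. Qed.
Fact isom_compVf Z : left_inverse (isom_id Z) (@isom_inv Z) (@isom_comp Z).
Proof.
move=> f; apply: isom_ext => z /=; apply: (@isom_inj _ f).
by rewrite isom_inv_funK.
Qed.

HB.instance Definition _ Z := isGroup.Build (isom Z) (@isom_compA Z)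
  (@isom_comp1f Z) (@isom_compf1 Z) (@isom_compVf Z) (@isom_compfV Z).

Lemma isom_mulE Z (f g : isom Z) z : (f * g)%g z = f (g z).
Proof. by []. Qed.

Lemma isom_invK Z (f : isom Z) z : f (f^-1%g z) = z.
Proof. exact: isom_inv_funK. Qed.

(* The strong operator topology. *)
HB.instance Definition _ Z := Topological.copy (isom Z)
  (initial_topology (fun f : isom Z => (f : Z -> Z) : {ptws Z -> Z})).

Lemma initial_cvgP (S : choiceType) (T : topologicalType) (f : S -> T)
    (F : set_system S) (s : S) : Filter F ->
  F --> (s : initial_topology f) <-> f x @[x --> F] --> f s.
Proof.
move=> FF; split=> [Fs|Ffs].
  by move=> A /(@initial_continuous _ _ f s); exact: Fs.
move=> A; rewrite nbhsE => -[B [[C oC <-] Cs]] /filterS; apply.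
by apply: Ffs; exact: open_nbhs_nbhs.
Qed.

Lemma isom_cvgP Z (F : set_system (isom Z)) (f : isom Z) : Filter F ->
  F --> f <-> forall z, (fun g : isom Z => g z) @ F --> f z.
Proof.
move=> FF; split=> [/initial_cvgP /cvg_sup Ff z|Ff].
  by have /initial_cvgP := Ff z.
by apply/initial_cvgP/cvg_sup => z; apply/initial_cvgP; exact: Ff.
Qed.

Lemma isom_eval_continuous Z (z : Z) : continuous (fun f : isom Z => f z).
Proof.
move=> f; have /isom_cvgP Hf : nbhs f --> f by exact: cvg_id.
exact: Hf.
Qed.

Lemma isom_mul_continuous Z :
  continuous (fun p : isom Z * isom Z => (p.1 * p.2)%g).
Proof.
move=> [f g]; apply/isom_cvgP => z; apply/cvgrPdist_lt => e e0 /=.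
have e20 : 0 < e / 2 by rewrite divr_gt0.
have /cvgrPdist_lt /(_ _ e20) Hf := @isom_eval_continuous Z (g z) f.
have /cvgrPdist_lt /(_ _ e20) Hg := @isom_eval_continuous Z z g.
near_simpl; near=> p; rewrite -[f (g z)](subrK (p.1 (g z))) -addrA.
rewrite (le_lt_trans (ler_normD _ _))// (splitr e) ltrD//.
  by near: p; apply: (cvg_fst Hf).
rewrite -linearB isom_norm.
by near: p; apply: (cvg_snd Hg).
Unshelve. all: by end_near. Qed.

Lemma isom_inv_continuous Z : continuous (fun f : isom Z => f^-1%g).
Proof.
move=> f; have FF := fmap_filter (fun f : isom Z => f^-1%g) (nbhs_filter f).
apply/isom_cvgP => z.
apply/cvgrPdist_lt => e e0; near_simpl.
have /cvgrPdist_lt /(_ _ e0) := @isom_eval_continuous Z (f^-1%g z) f.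
apply: filterS => g; rewrite isom_invK => zg.
by rewrite -(isom_norm g) linearB isom_invK distrC.
Qed.

HB.instance Definition _ Z := isTopologicalGroup.Build (isom Z)
  (@isom_mul_continuous Z) (@isom_inv_continuous Z).

End Isom.

Section Subspace.
Context {K : numFieldType} {X : normedModType K}.

(* Linear subspaces of [X] are closed predicates [Y : submodClosed X]; [subsp Y]
   is [Y] as a normed space with the norm of [X]. *)
Definition subsp (Y : submodClosed X) := {x : X | x \in Y}.

HB.instance Definition _ Y := [isSub of subsp Y for @sval X _].
HB.instance Definition _ Y := [Choice of subsp Y by <:].
HB.instance Definition _ Y := [SubChoice_isSubLmodule of subsp Y by <:].

Section norm.
Variable Y : submodClosed X.
Let norm (y : subsp Y) : K := `|val y|.
Let normD x y : norm (x + y) <= norm x + norm y.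
Proof. by rewrite /norm raddfD ler_normD. Qed.
Let normZ (l : K) x : norm (l *: x) = `|l| * norm x.
Proof. by rewrite /norm linearZ normrZ. Qed.
Let norm0_eq0 x : norm x = 0 -> x = 0.
Proof. by move=> /normr0_eq0 x0; apply: val_inj; rewrite x0 raddf0. Qed.
HB.instance Definition _ :=
  Lmodule_isNormed.Build K (subsp Y) normD normZ norm0_eq0.
End norm.

Lemma subsp_normE (Y : submodClosed X) (y : subsp Y) : `|y| = `|val y|.
Proof. by []. Qed.

Definition finite_dim (F : submodClosed X) : Prop :=
  exists (n : nat) (b : 'I_n -> X),
    forall x, x \in F <-> exists a : 'I_n -> K, x = \sum_i a i *: b i.

End Subspace.

Section Nets.

Definition directed (I : Type) (le : I -> I -> Prop) : Prop :=
  [/\ inhabited I,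
      forall i, le i i,
      forall i j k, le i j -> le j k -> le i k
    & forall i j, exists2 k, le i k & le j k].

(* The filter of tails, so that [u i @[i --> tails le] --> l] is convergence of
   the net [u]. *)
Definition tails (I : Type) (le : I -> I -> Prop) : set_system I :=
  filter_from setT (fun i => [set j | le i j]).

Lemma tails_proper (I : Type) (le : I -> I -> Prop) :
  directed le -> ProperFilter (tails le).
Proof.
move=> [[i0] le_refl le_trans le_dir].
apply: filter_from_proper => [|i _]; last by exists i; exact: le_refl.
apply: filter_from_filter => [|i j _ _]; first by exists i0.
have [k ik jk] := le_dir i j; exists k => // l kl.
by split; [exact: le_trans ik kl | exact: le_trans jk kl].
Qed.

End Nets.

Section Envelope.
Context {K : numFieldType} {X : normedModType K}.

(* The last inequality is [||T|_F - t|| <= eps] for the operator norm. *)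
Definition approximately_ultrahomogeneous : Prop :=
  forall F : submodClosed X, finite_dim F ->
  forall t : {linear subsp F -> X}, (forall u, `|t u| = `|u|) ->
  forall eps : K, 0 < eps ->
  exists T : isom X, forall u : subsp F, `|T (val u) - t u| <= eps * `|u|.

Definition envelope (Y : {pred X}) : set X :=
  [set x | forall (I : Type) (le : I -> I -> Prop) (T : I -> isom X),
    directed le ->
    (forall y, y \in Y -> T i y @[i --> tails le] --> y) ->
    T i x @[i --> tails le] --> x].

Definition Env (Y : submodClosed X) : {pred X} := fun x => x \in envelope Y.

Lemma EnvP (Y : submodClosed X) x : reflect (envelope Y x) (x \in Env Y).
Proof. by rewrite unfold_in; apply: (iffP idP); rewrite inE. Qed.

Lemma Env_submod_closed Y : submod_closed (Env Y).
Proof.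
split=> [|a x y /EnvP xE /EnvP yE]; apply/EnvP => I le T le_dir TY;
  have FF := tails_proper le_dir.
  by under eq_fun do rewrite linear0; exact: cvg_cst.
under eq_fun do rewrite linearP.
by apply: cvgD; [apply: cvgZr; exact: xE|exact: yE].
Qed.

HB.instance Definition _ Y :=
  GRing.isSubmodClosed.Build K X (Env Y) (GRing.submod_closed_semi (Env_submod_closed Y)).

Lemma sub_Env (Y : submodClosed X) : {subset Y <= Env Y}.
Proof. by move=> y yY; apply/EnvP => I le T _; exact. Qed.

Definition env_incl (Y : submodClosed X) (y : subsp Y) : subsp (Env Y) :=
  exist _ (val y) (sub_Env (valP y)).

End Envelope.

Section Embedding.
Context {K : numFieldType}.

(* [t'] restricts to [t] on [Y], seen as a subspace of [Z] through the inclusion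
   map [i]. *)
Definition extends (Y Z : normedModType K) (i : Y -> Z)
    (t' : isom Z) (t : isom Y) : Prop :=
  forall y, t' (i y) = i (t y).

(* Here [i] is the inclusion map of the subspace [Y] into [Z]. *)
Definition linear_g_embedding (Y Z : normedModType K) (i : Y -> Z) : Prop :=
  [/\ linear i, forall y, `|i y| = `|y|
    & exists2 e : isom Y -> isom Z,
        topological_group_embedding e & forall h, extends i (e h) h].

End Embedding.

Arguments env_incl {K X} Y y.
Arguments approximately_ultrahomogeneous {K} X.

(* Main.v *)
Require Import Defs.
From HB Require Import structures.
From mathcomp Require Import all_boot all_order all_algebra.
From mathcomp Require Import all_classical all_reals all_analysis.
From mathcomp Require Import ring.

Set Implicit Arguments.
Unset Strict Implicit.
Unset Printing Implicit Defensive.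

(** Membership of [x] in [Env Y] amounts to a modulus of continuity: for every
    [e > 0] there are finitely many vectors of [Y] such that two isometries [S]
    and [T] of [X] which are close on these vectors satisfy [`|S x - T x| < e]
    ([envelope_modulus]).  Otherwise the counterexamples [S^-1 * T], indexed by
    the finite lists of vectors of [Y], would form a net converging to the
    identity on [Y] but not at [x].  As [Y] is closed under scaling, closeness
    may always be taken to mean distance less than [1], so that a finite list
    alone encodes both the vectors and the tolerance.

    Approximate ultrahomogeneity says that a linear isometric embedding into [X]
    of a subspace of [X] is approximated, on any finite list, by isometries of
    [X] ([approx_isometry]).  It therefore transports the modulus from
    isometries of [X] to linear isometric embeddings of [Env Y] into [X]
    ([embedding_modulus]).  This one statement gives the uniqueness of
    extensions, hence the multiplicativity of the extension map, and also the
    continuity of that map.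

    For existence, the isometries of [X] that approximate [t] on finite lists
    of [Y] form a filter base.  By the modulus, their values at a point [x] of
    [Env Y] are Cauchy along this filter, and the limit, as a function of [x],
    is a linear isometry extending [t].  It stays in [Env Y]: an isometry of
    [X] which almost fixes the vectors [t y] almost commutes, on the
    corresponding [y], with an approximant of [t], so the modulus applies.  The
    limits for [t] and [t^-1] are mutually inverse by uniqueness, which gives
    surjectivity.  Finally the extension map is open onto its image because
    [t y] is read off from the value at [y] of the extension of [t]. *)

Import Order.TTheory GRing.Theory Num.Theory.
Import numFieldNormedType.Exports.

Local Open Scope classical_set_scope.
Local Open Scope ring_scope.

(** * Norm estimates, filters and isometries *)

Section Prelim.
Context {K : numFieldType}.

(** Scaling vectors trades a tolerance [e] for the tolerance [1]. *)
Lemma norm_scaleV_lt1 (V : normedModType K) (e : K) (v : V) : 0 < e ->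
  (`|e^-1 *: v| < 1) = (`|v| < e).
Proof.
by move=> e0; rewrite normrZ normfV (gtr0_norm e0) ltr_pdivrMl// mulr1.
Qed.

Lemma normB_lt_third (V : normedModType K) (e : K) (a b c d : V) :
  `|a - b| < e / 3 -> `|b - c| < e / 3 -> `|c - d| < e / 3 -> `|a - d| < e.
Proof.
move=> ab bc cd.
have -> : a - d = (a - b) + (b - c) + (c - d) by rewrite !addrA !subrK.
have -> : e = e / 3 + e / 3 + e / 3 by field.
by do 2! [apply: (le_lt_trans (ler_normD _ _)); apply: ltrD => //].
Qed.

Lemma near_seq (T : Type) (F : set_system T) (I : eqType) (s : seq I)
    (P : T -> I -> Prop) : Filter F ->
  (forall i, i \in s -> \forall x \near F, P x i) ->
  \forall x \near F, forall i, i \in s -> P x i.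
Proof.
move=> FF; elim: s => [|i s IH] Ps; first by apply: nearW.
have Pi := Ps i (mem_head _ _).
have {}IH : \forall x \near F, forall j, j \in s -> P x j.
  by apply: IH => j js; apply: Ps; rewrite inE js orbT.
apply: filterS2 Pi IH => x Pi Ps' j; rewrite inE => /predU1P[->//|]; exact: Ps'.
Qed.

Definition isometric (V W : normedModType K) (f : V -> W) : Prop :=
  forall v, `|f v| = `|v|.

Lemma isom_of_fun (Z : normedModType K) (f : Z -> Z) :
  linear f -> isometric f -> (forall w, exists z, f z = w) ->
  exists g : isom Z, g =1 f.
Proof.
move=> fL fN fS.
pose f' : {linear Z -> Z} :=
  HB.pack f (GRing.isLinear.Build K Z Z *:%R f fL).
by exists (@Isom K Z f' fN fS).
Qed.

End Prelim.

(** * Approximating an isometric embedding on a finite list *)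

Section Span.
Context {K : numFieldType} {X : normedModType K}.

Definition span_of (n : nat) (b : 'I_n -> X) : {pred X} :=
  fun x => `[< exists a : 'I_n -> K, x = \sum_i a i *: b i >].

Lemma span_of_submod_closed n (b : 'I_n -> X) : submod_closed (span_of b).
Proof.
split=> [|c x y /asboolP[p ->] /asboolP[q ->]]; apply/asboolP.
  by exists (fun=> 0); rewrite big1// => i _; rewrite scale0r.
exists (fun i => c * p i + q i); rewrite scaler_sumr -big_split /=.
by apply: eq_bigr => i _; rewrite scalerDl scalerA.
Qed.

HB.instance Definition _ n (b : 'I_n -> X) :=
  GRing.isSubmodClosed.Build K X (span_of b)
    (GRing.submod_closed_semi (span_of_submod_closed b)).

Lemma span_of_finite_dim n (b : 'I_n -> X) : finite_dim (span_of b).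
Proof. by exists n, b => x; split=> [/asboolP|?]//; apply/asboolP. Qed.

Lemma mem_span_of n (b : 'I_n -> X) i : b i \in span_of b.
Proof.
apply/asboolP; exists (fun j => (j == i)%:R).
by rewrite (bigD1 i)//= eqxx scale1r big1 ?addr0// => j /negPf ->; rewrite scale0r.
Qed.

Lemma span_of_sub (W : submodClosed X) n (b : 'I_n -> X) :
  (forall i, b i \in W) -> {subset span_of b <= W}.
Proof.
by move=> bW x /asboolP[a ->]; apply: rpred_sum => i _; exact: rpredZ.
Qed.

(** Ultrahomogeneity applied to the span of [s].  It bounds the error relative
    to the norm, so the relative error is chosen to be the inverse of a number
    larger than the norms of all elements of [s]. *)
Lemma approx_isometry (W : submodClosed X) (f : {linear subsp W -> X})
    (s : seq (subsp W)) :
  approximately_ultrahomogeneous X -> isometric f ->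
  exists T : isom X, forall w, w \in s -> `|T (val w) - f w| < 1.
Proof.
move=> auh fN.
pose b (i : 'I_(size s)) : X := val (nth 0 s i).
have bW : {subset span_of b <= W} by apply: span_of_sub => i; exact: valP.
pose j (u : subsp (span_of b)) : subsp W := exist _ (val u) (bW _ (valP u)).
have jL : linear (f \o j).
  move=> a u v /=; rewrite -linearP; congr (f _).
  by apply: val_inj; rewrite !(linearD, linearZ).
pose t : {linear subsp (span_of b) -> X} :=
  HB.pack (f \o j) (GRing.isLinear.Build K _ _ *:%R _ jL).
have tN u : `|t u| = `|u| by rewrite /= fN.
pose m : K := 1 + \sum_(w <- s) `|w|.
have m0 : 0 < m by rewrite ltr_pwDl// sumr_ge0.
have mV0 : 0 < m^-1 by rewrite invr_gt0.
have [T TP] := auh _ (span_of_finite_dim b) t tN _ mV0.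
exists T => w ws.
have wb : val w \in span_of b.
  rewrite -(nth_index 0 ws); have := ws; rewrite -index_mem => lt.
  exact: (mem_span_of b (Ordinal lt)).
have := TP (exist _ (val w) wb); rewrite /= subsp_normE /=.
have -> : j (exist _ (val w) wb) = w by exact: val_inj.
move=> /le_lt_trans; apply.
rewrite mulrC ltr_pdivrMr// mul1r -subsp_normE.
rewrite /m (perm_big _ (perm_to_rem ws)) big_cons /=.
by rewrite addrCA ltrDl ltr_pwDl// sumr_ge0.
Qed.

End Span.

(** * The modulus of continuity on the envelope *)

Section Modulus.
Context {K : numFieldType} {X : normedModType K} (Y : submodClosed X).

(** The net definition of the envelope in uniform form: a list [s] at which the
    conclusion fails yields [U s := S^-1 * T], and the net [U] over lists ordered
    by inclusion converges to the identity on [Y]. *)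
Lemma envelope_modulus (x : X) (e : K) : x \in Env Y -> 0 < e ->
  exists s : seq (subsp Y), forall S T : isom X,
    (forall y, y \in s -> `|S (val y) - T (val y)| < 1) -> `|S x - T x| < e.
Proof.
move=> /EnvP xE e0; apply: contrapT => nmod.
have bad (s : seq (subsp Y)) : exists U : isom X,
    (forall y, y \in s -> `|val y - U (val y)| < 1) /\ ~ `|x - U x| < e.
  apply: contrapT => nbad; apply: nmod; exists s => S T ST.
  apply: contrapT => nlt; apply: nbad; exists (S^-1 * T)%g; split=> [y ys|].
    rewrite isom_mulE -(isom_norm S) linearB isom_invK; exact: ST.
  by rewrite isom_mulE -(isom_norm S) linearB isom_invK.
pose U s := projT1 (cid (bad s)).
have UP s : (forall y, y \in s -> `|val y - U s (val y)| < 1) /\ ~ `|x - U s x| < e.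
  exact: projT2 (cid (bad s)).
pose le (s s' : seq (subsp Y)) : Prop := {subset s <= s'}.
have le_dir : directed le.
  split=> [|s y //|r s t rs st y /rs /st //|s t]; first by exists; exact: [::].
  by exists (s ++ t) => y yst; rewrite mem_cat yst ?orbT.
have FF := tails_proper le_dir.
suff /(xE _ le U le_dir) : forall y, y \in Y ->
    U s y @[s --> tails le] --> y.
  move=> /cvgrPdist_lt /(_ _ e0) [s _ /(_ s (fun _ => id))].
  by have [_] := UP s.
move=> y yY; apply/cvgrPdist_lt => d d0.
(* A list containing [d^-1 *: y] forces [U s] to move [y] by less than [d]. *)
exists [:: d^-1 *: (exist _ y yY : subsp Y)] => // s ys.
have [/(_ _ (ys _ (mem_head _ _))) + _] := UP s.
by rewrite !linearZ/= -scalerDr norm_scaleV_lt1.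
Qed.

Hypothesis auh : approximately_ultrahomogeneous X.

(** Both embeddings are replaced by isometries of [X] close to them on [x] and on
    the list that [envelope_modulus] provides; each triangle inequality has three
    terms, whence the thirds. *)
Lemma embedding_modulus (x : subsp (Env Y)) (e : K) : 0 < e ->
  exists s : seq (subsp Y), forall f g : {linear subsp (Env Y) -> X},
    isometric f -> isometric g ->
    (forall y, y \in s -> `|f (env_incl Y y) - g (env_incl Y y)| < 1) ->
    `|f x - g x| < e.
Proof.
move=> e0; have e30 : 0 < e / 3 by rewrite divr_gt0.
have k0 : 0 < 1 / 3 :> K by rewrite divr_gt0.
have [s sP] := envelope_modulus (valP x) e30.
exists [seq (1 / 3)^-1 *: y | y <- s] => f g fN gN fg.
pose r := (e / 3)^-1 *: x :: [seq (1 / 3)^-1 *: env_incl Y y | y <- s].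
have appr (h : {linear subsp (Env Y) -> X}) : isometric h ->
    exists T : isom X, `|T (val x) - h x| < e / 3 /\
      forall y, y \in s -> `|T (val y) - h (env_incl Y y)| < 1 / 3.
  move=> hN; have [T Tr] := approx_isometry r auh hN; exists T; split=> [|y ys].
    by have := Tr _ (mem_head _ _); rewrite !linearZ/= -scalerDr norm_scaleV_lt1.
  have /Tr : (1 / 3)^-1 *: env_incl Y y \in r.
    by apply: mem_behead; exact: (map_f (fun y => _ *: env_incl Y y) ys).
  by rewrite !linearZ/= -scalerDr norm_scaleV_lt1.
have [S [Sx Ss]] := appr f fN; have [T [Tx Ts]] := appr g gN.
apply: (normB_lt_third _ _ Tx); first by rewrite distrC; exact: Sx.
apply: sP => y ys; apply: (normB_lt_third (c := g (env_incl Y y)) (Ss y ys)).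
  have := fg _ (map_f (fun y => (1 / 3)^-1 *: y) ys).
  have -> : env_incl Y ((1 / 3)^-1 *: y) = (1 / 3)^-1 *: env_incl Y y.
    by apply: val_inj; rewrite !linearZ.
  by rewrite !linearZ/= -scalerDr norm_scaleV_lt1.
by rewrite distrC; exact: Ts.
Qed.

Lemma embedding_unique (f g : {linear subsp (Env Y) -> X}) :
  isometric f -> isometric g ->
  (forall y, f (env_incl Y y) = g (env_incl Y y)) -> f =1 g.
Proof.
move=> fN gN fg x; apply/eqP; rewrite -subr_eq0 -normr_le0.
apply/ler_addgt0Pr => e e0; rewrite add0r; apply: ltW.
have [s] := embedding_modulus x e0; apply => // y _.
by rewrite fg subrr normr0.
Qed.

End Modulus.

(** * Extending an isometry to the envelope *)

Section Extension.
Context {K : numFieldType} {X : completeNormedModType K} (Y : submodClosed X).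
Hypothesis auh : approximately_ultrahomogeneous X.

Lemma val_isometric (W : submodClosed X) (t : isom (subsp W)) :
  isometric (val \o t).
Proof. by move=> w; rewrite /= -subsp_normE isom_norm. Qed.

Lemma env_incl_linear : linear (env_incl Y).
Proof. by move=> a u v; apply: val_inj; rewrite !(linearD, linearZ). Qed.

Section Limit.
Variable t : isom (subsp Y).

(** The filter stands for a net of isometries of [X] converging to [t] on [Y]. *)
Definition approximants : set_system (isom X) :=
  filter_from setT (fun s : seq (subsp Y) =>
    [set T : isom X | forall y, y \in s -> `|T (val y) - val (t y)| < 1]).

Lemma approximants_proper : ProperFilter approximants.
Proof.
apply: filter_from_proper => [|s _].
  apply: filter_from_filter; first by exists [::].
  move=> r s _ _; exists (r ++ s) => // T Trs.
  by split=> y ys; apply: Trs; rewrite mem_cat ys ?orbT.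
have [T Ts] := approx_isometry s auh (val_isometric t).
by exists T.
Qed.
#[local] Existing Instance approximants_proper.

Lemma approximants_cvg (y : subsp Y) :
  (fun T : isom X => T (val y)) @ approximants --> val (t y).
Proof.
apply/cvgrPdist_lt => e e0; exists [:: e^-1 *: y] => // T /(_ _ (mem_head _ _)).
by rewrite !linearZ/= -scalerDr norm_scaleV_lt1// distrC.
Qed.

(** Two approximants that are close to [t] on the list given by the modulus at
    [x] are close to each other there, hence close at [x]. *)
Lemma approximants_eval_cvg (x : X) : x \in Env Y ->
  cvg ((fun T : isom X => T x) @ approximants).
Proof.
move=> xE; apply: cauchy_cvg; apply/cauchyP => e e0.
have k0 : 0 < 1 / 2 :> K by rewrite divr_gt0.
have [s sP] := envelope_modulus xE e0.
have close : approximants (fun T : isom X => forall y, y \in s ->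
    `|val (t y) - T (val y)| < 1 / 2).
  apply: (near_seq approximants_proper) => y _.
  have /cvgrPdist_lt := @approximants_cvg y; exact.
have [T Ts] := filter_ex close.
exists (T x); apply: filterS close => S Ss; rewrite -ball_normE /=.
apply: (sP T S) => y ys; rewrite (splitr 1).
apply: (le_lt_trans (ler_distD (val (t y)) _ _)); apply: ltrD.
  by rewrite distrC; exact: Ts.
exact: Ss.
Qed.

Definition limit_fun (x : subsp (Env Y)) : X :=
  lim ((fun T : isom X => T (val x)) @ approximants).

Lemma limit_funP x : (fun T : isom X => T (val x)) @ approximants --> limit_fun x.
Proof. exact: approximants_eval_cvg (valP x). Qed.

Lemma limit_fun_eq x (l : X) :
  (fun T : isom X => T (val x)) @ approximants --> l -> limit_fun x = l.
Proof. exact: cvg_lim. Qed.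

(** If a net [U] fixes [Y] asymptotically then, for an approximant [T], the
    vectors [U i (T y)] and [T y] are both close to [t y]; the modulus at [x]
    applied to [T] and [U i * T] then shows that [U i] almost fixes [T x], which
    is close to the limit. *)
Lemma limit_fun_env (x : subsp (Env Y)) : limit_fun x \in Env Y.
Proof.
apply/EnvP => I le U le_dir UY; have FF := tails_proper le_dir.
apply/cvgrPdist_lt => e e0.
have e30 : 0 < e / 3 by rewrite divr_gt0.
have k0 : 0 < 1 / 3 :> K by rewrite divr_gt0.
have [s sP] := envelope_modulus (valP x) e30.
have [T [Tx Ts]] : exists T : isom X, `|limit_fun x - T (val x)| < e / 3 /\
    forall y, y \in s -> `|val (t y) - T (val y)| < 1 / 3.
  have Tx : approximants (fun T : isom X => `|limit_fun x - T (val x)| < e / 3).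
    by have /cvgrPdist_lt := @limit_funP x; exact.
  have Ts : approximants (fun T : isom X => forall y, y \in s ->
      `|val (t y) - T (val y)| < 1 / 3).
    apply: (near_seq approximants_proper) => y _.
    by have /cvgrPdist_lt := @approximants_cvg y; exact.
  exact: filter_ex (filterI Tx Ts).
have Us : \forall i \near tails le, forall y, y \in s ->
    `|val (t y) - U i (val (t y))| < 1 / 3.
  apply: (near_seq FF) => y _.
  by have /cvgrPdist_lt := UY _ (valP (t y)); exact.
apply: filterS Us => i Us.
apply: (normB_lt_third Tx).
  apply: (sP T (U i * T)%g) => y ys; rewrite isom_mulE.
  apply: (normB_lt_third _ (Us y ys)); first by rewrite distrC; exact: Ts.
  by rewrite -linearB isom_norm; exact: Ts.
by rewrite isom_mulE -linearB isom_norm distrC.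
Qed.

Definition limit_ext (x : subsp (Env Y)) : subsp (Env Y) :=
  exist _ (limit_fun x) (limit_fun_env x).

Lemma limit_ext_linear : linear limit_ext.
Proof.
move=> a u v; apply: val_inj; rewrite linearP /=; apply: limit_fun_eq.
under eq_fun do rewrite !linearP.
by apply: cvgD; [apply: cvgZr|]; exact: limit_funP.
Qed.

HB.instance Definition _ :=
  GRing.isLinear.Build K _ _ *:%R limit_ext limit_ext_linear.

Lemma limit_ext_isometric : isometric limit_ext.
Proof.
move=> x; rewrite !subsp_normE /=.
have FF : ProperFilter approximants by exact _.
have lN : (fun T : isom X => `|T (val x)|) @ approximants --> `|limit_fun x|.
  by apply: cvg_norm; exact: limit_funP.
have cN : (fun T : isom X => `|T (val x)|) @ approximants --> `|val x|.
  by under eq_fun do rewrite isom_norm; exact: cvg_cst.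
exact: (cvg_unique (@norm_hausdorff _ K^o) lN cN).
Qed.

Lemma limit_ext_extends y : limit_ext (env_incl Y y) = env_incl Y (t y).
Proof. by apply: val_inj; apply: limit_fun_eq; exact: approximants_cvg. Qed.

End Limit.

Lemma extension_unique (t : isom (subsp Y)) (t1 t2 : isom (subsp (Env Y))) :
  extends (env_incl Y) t1 t -> extends (env_incl Y) t2 t -> t1 = t2.
Proof.
move=> e1 e2; apply: isom_ext => x; apply: val_inj.
apply: (embedding_unique auh (val_isometric t1) (val_isometric t2)) => y.
by rewrite /= e1 e2.
Qed.

Lemma extension_exists (t : isom (subsp Y)) :
  exists t' : isom (subsp (Env Y)), extends (env_incl Y) t' t.
Proof.
have [|||t' t'E] := @isom_of_fun _ _ (limit_ext t).
- exact: limit_ext_linear.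
- exact: limit_ext_isometric.
- (* The two extensions compose to an embedding that is the identity on [Y]. *)
  move=> w; exists (limit_ext t^-1%g w); apply: val_inj.
  pose f : {linear subsp (Env Y) -> X} := val \o limit_ext t \o limit_ext t^-1%g.
  apply: (embedding_unique auh (f := f) (g := val)) => [v|v|y] //=.
    have := limit_ext_isometric t (limit_ext t^-1%g v).
    by rewrite (limit_ext_isometric t^-1%g v).
  rewrite limit_ext_extends.
  by have /(congr1 val) := limit_ext_extends t (t^-1%g y); rewrite isom_invK.
by exists t' => y; rewrite t'E limit_ext_extends.
Qed.

(** * The extension map as an embedding of topological groups *)

Section Embedding.
Variable e : isom (subsp Y) -> isom (subsp (Env Y)).
Hypothesis eE : forall t, extends (env_incl Y) (e t) t.

(** Both sides extend [g * h]. *)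
Lemma ext_morph : {morph e : g h / (g * h)%g}.
Proof.
move=> g h; apply: (extension_unique (eE _)) => y.
by rewrite !isom_mulE !eE.
Qed.

Lemma ext_inj : injective e.
Proof.
move=> g h gh; apply: isom_ext => y; apply: val_inj.
by have /(congr1 val) := eE g y; rewrite gh eE => /esym.
Qed.

(** At [x], the modulus bounds the variation of [e t x] by that of [t] on
    finitely many vectors of [Y]. *)
Lemma ext_continuous : continuous e.
Proof.
move=> t0; have FF := fmap_filter e (nbhs_filter t0).
apply/isom_cvgP => x; apply/cvgrPdist_lt => d d0; near_simpl.
have [s sP] := embedding_modulus auh x d0.
have ts : nbhs t0 (fun t : isom (subsp Y) => forall y, y \in s ->
    `|t0 y - t y| < 1).
  apply: (near_seq (nbhs_filter t0)) => y _.
  by have /cvgrPdist_lt := @isom_eval_continuous _ _ y t0; exact.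
apply: filterS ts => t ts.
apply: (sP (val \o e t0) (val \o e t)) => [||y ys]; try exact: val_isometric.
by rewrite /= !eE; exact: ts.
Qed.

(** [e t] determines [t y] as its value at [y], so the topology pulled back along
    [e] is at least as fine as that of [isom (subsp Y)]. *)
Lemma ext_inv_continuous (t : isom (subsp Y)) (U : set (isom (subsp Y))) :
  nbhs t U -> exists2 V, nbhs (e t) V & e @^-1` V `<=` U.
Proof.
pose F := filter_from (nbhs (e t)) (fun V => e @^-1` V).
have FF : Filter F.
  apply: filter_from_filter; first by exists setT; exact: filterT.
  by move=> V W nV nW; exists (V `&` W); [exact: filterI|].
suff : F --> t by exact.
apply/isom_cvgP => y; apply/cvgrPdist_lt => d d0.
exists (fun g : isom (subsp (Env Y)) =>
    `|e t (env_incl Y y) - g (env_incl Y y)| < d).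
  by have /cvgrPdist_lt := @isom_eval_continuous _ _ (env_incl Y y) (e t); exact.
by move=> h /=; rewrite !eE.
Qed.

Lemma ext_embedding : topological_group_embedding e.
Proof.
split; [exact: ext_morph|exact: ext_inj|exact: ext_continuous|move=> U oU].
exists (\bigcup_(V in [set V | open V /\ e @^-1` V `<=` U]) V).
  by apply: bigcup_open => V [].
apply/seteqP; split=> [_ [t Ut <-]|_ [[t _ <-] [V [_ VU] /VU Ut]]]; last by exists t.
split; first by exists t.
have [V + VU] := ext_inv_continuous (open_nbhs_nbhs (conj oU Ut)).
rewrite nbhsE => -[W [oW Wt] WV].
by exists W => //; split=> // h /WV /VU.
Qed.

End Embedding.

End Extension.

Theorem proposition2p40 (K : numFieldType) (X : completeNormedModType K)
    (Y : submodClosed X) :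
  approximately_ultrahomogeneous X ->
  [/\ forall t : isom (subsp Y),
        exists! t' : isom (subsp (Env Y)), extends (env_incl Y) t' t,
      exists e : isom (subsp Y) -> isom (subsp (Env Y)),
        [/\ forall t, extends (env_incl Y) (e t) t,
            topological_group_embedding e
          & forall e' : isom (subsp Y) -> isom (subsp (Env Y)),
              (forall t, extends (env_incl Y) (e' t) t) -> e' = e]
    & linear_g_embedding (env_incl Y)].
Proof.
move=> auh; have [e eE] := choice (extension_exists (Y := Y) auh).
have eemb := ext_embedding auh eE.
split; last 1 first.
- by split; [exact: env_incl_linear| |exists e].
- move=> t; exists (e t); split=> [|t' t'E]; first exact: eE.
  exact: extension_unique (eE t) t'E.
- exists e; split=> // e' e'E; apply/funext => t.
  exact: extension_unique (e'E t) (eE t).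
Qed.
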